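(* Let $k\ge2$ be an integer. Among the sets $\mathscr{N}_k(Q)$, $\mathscr{N}^{I}_k(Q)$, $\mathscr{N}^{II}_k(Q)$, for basic sequences $Q$ that are infinite in limit and fully divergent of types I and II, the only containment between two different ones is $\mathscr{N}^{I}_k(Q)\subseteq\mathscr{N}_k(Q)$. That is: for every such $Q$, $\mathscr{N}^I_k(Q)\subseteq\mathscr{N}_k(Q)$; and for each of the other five ordered pairs $(\mathscr{A},\mathscr{B})$ of distinct members of $\{\mathscr{N}_k,\mathscr{N}^I_k,\mathscr{N}^{II}_k\}$ there exists a basic sequence $Q$, infinite in limit and fully divergent of types I and II, such that $\mathscr{A}(Q)\not\subseteq\mathscr{B}(Q)$.
   Context: A basic sequence is a sequence $Q=(q_n)_{n\ge1}$ of integers $q_n\ge2$; it is infinite in limit if $q_n\to\infty$. Each real $x$ has a unique $Q$-Cantor series expansion $x=E_0+\sum_{n\ge1}\frac{E_n}{q_1\cdots q_n}$ with $E_0=\lfloor x\rfloor$, $E_n\in\{0,\dots,q_n-1\}$ and $E_n\ne q_n-1$ infinitely often; write $x=E_0.E_1E_2\dots$ w.r.t. $Q$. A block is a finite tuple of non-negative integers. For a block $B$ of length $k$, $N_n^Q(B,x)$ is the number of $p$ with $1\le p\le n$ and $(E_p,\dots,E_{p+k-1})=B$. Put $Q_n^{(k)}=\sum_{j=1}^n\frac1{q_j\cdots q_{j+k-1}}$; $\mathscr{N}_k(Q)$ is the set of real $x$ with $\lim_n N_n^Q(B,x)/Q_n^{(k)}=1$ for all blocks $B$ of length $k$. For $m\ge1$,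 $0\le r\le m-1$: $N^Q_{n,m,r}(B,x)$ counts occurrences of $B$ at positions $p$ with $1\le p\le n$, $p\equiv r\pmod m$, and $Q^{(k)}_{n,m,r}=\sum_{1\le p\le n,\ p\equiv r\ (m)}\frac1{q_p\cdots q_{p+k-1}}$. $\mathscr{N}^I_{k,m,r}(Q)$ is the set of real $x$ with $\lim_n N^Q_{n,m,r}(B,x)/Q^{(k)}_{n,m,r}=1$ for all blocks $B$ of length $k$; $\mathscr{N}^I_{k,m}(Q)=\bigcap_{r=0}^{m-1}\mathscr{N}^I_{k,m,r}(Q)$; $\mathscr{N}^I_k(Q)=\bigcap_{m=1}^k\mathscr{N}^I_{k,m}(Q)$. Let $p_1<p_2<\cdots$ be the positive integers congruent to $r$ mod $m$; put $\Lambda_{m,r}(Q)=(q_{p_1},q_{p_2},\dots)$ and $\Upsilon_{Q,m,r}(x)=0.E_{p_1}E_{p_2}\dots$ w.r.t. $\Lambda_{m,r}(Q)$. $\mathscr{N}^{II}_{k,m,r}(Q)=\{x:\Upsilon_{Q,m,r}(x)\in\mathscr{N}_k(\Lambda_{m,r}(Q))\}$ and $\mathscr{N}^{II}_k(Q)=\bigcap_{r=0}^{k-1}\mathscr{N}^{II}_{k,k,r}(Q)$. $Q$ is fully divergent of type I if $\lim_nQ^{(k)}_{n,m,r}=\infty$ for all $k\ge1$, $m\ge1$, $0\le r\le m-1$; fully divergent of type II if $\lim_n(\Lambda_{k,r}(Q))^{(k)}_n=\infty$ for all $k\ge1$, $0\le r\le k-1$. *)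

(* Defs.v *)
From HB Require Import structures.
From mathcomp Require Import all_boot all_order all_algebra.
From mathcomp Require Import all_classical all_reals all_analysis.

Set Implicit Arguments.
Unset Strict Implicit.
Unset Printing Implicit Defensive.

Import Order.TTheory GRing.Theory Num.Theory.
Import numFieldNormedType.Exports.

Local Open Scope classical_set_scope.
Local Open Scope ring_scope.

(* Basic sequences and digit sequences are functions nat -> nat read from
   index 1 on; their value at 0 is never used. *)

Definition basic (Q : nat -> nat) : Prop :=
  forall n : nat, (1 <= n)%N -> (2 <= Q n)%N.

Definition infinite_in_limit (Q : nat -> nat) : Prop := Q @ \oo --> \oo.

Section Expansion.
Variable R : realType.

Definition cantor_partial_sum (Q E : nat -> nat) (n : nat) : R :=
  \sum_(1 <= j < n.+1) (E j)%:R / \prod_(1 <= i < j.+1) (Q i)%:R.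

(* The integer part E_0 is not stored in E: it is always Num.floor x. *)
Definition cantor_expansion (Q : nat -> nat) (x : R) (E : nat -> nat) : Prop :=
  [/\ forall n : nat, (1 <= n)%N -> (E n <= Q n - 1)%N,
      forall n0 : nat, exists2 n : nat, (n0 < n)%N & E n <> (Q n - 1)%N &
      (Num.floor x)%:~R + cantor_partial_sum Q E n @[n --> \oo] --> x].

(* For basic Q the expansion exists and is unique at the indices n >= 1, so the
   default value and the choice made by xget are irrelevant there. *)
Definition digits (Q : nat -> nat) (x : R) : nat -> nat :=
  xget (fun=> 0%N) [set E | cantor_expansion Q x E].

End Expansion.

Definition occurs_at (k : nat) (B : k.-tuple nat) (E : nat -> nat) (p : nat) :
    bool :=
  [forall i : 'I_k, E (p + i)%N == tnth B i].

Definition block_count (R : realType) (Q : nat -> nat) (k : nat)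
    (B : k.-tuple nat) (x : R) (n : nat) : nat :=
  \sum_(1 <= p < n.+1 | occurs_at B (digits Q x) p) 1.

Definition block_count_mod (R : realType) (Q : nat -> nat) (m r k : nat)
    (B : k.-tuple nat) (x : R) (n : nat) : nat :=
  \sum_(1 <= p < n.+1 | (p == r %[mod m]) && occurs_at B (digits Q x) p) 1.

Definition expected_count (R : realType) (Q : nat -> nat) (k n : nat) : R :=
  \sum_(1 <= p < n.+1) (\prod_(p <= i < p + k) (Q i)%:R)^-1.

Definition expected_count_mod (R : realType) (Q : nat -> nat) (m r k n : nat) :
    R :=
  \sum_(1 <= p < n.+1 | p == r %[mod m]) (\prod_(p <= i < p + k) (Q i)%:R)^-1.

Section Normality.
Variable R : realType.

Definition normal_set (k : nat) (Q : nat -> nat) : set R :=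
  [set x | forall B : k.-tuple nat,
    (block_count Q B x n)%:R / expected_count R Q k n @[n --> \oo] --> (1 : R)].

Definition normalI_set_mod_res (k m r : nat) (Q : nat -> nat) : set R :=
  [set x | forall B : k.-tuple nat,
    (block_count_mod Q m r B x n)%:R / expected_count_mod R Q m r k n
      @[n --> \oo] --> (1 : R)].

Definition normalI_set_mod (k m : nat) (Q : nat -> nat) : set R :=
  \bigcap_(r in [set r | (r < m)%N]) normalI_set_mod_res k m r Q.

Definition normalI_set (k : nat) (Q : nat -> nat) : set R :=
  \bigcap_(m in [set m | (1 <= m <= k)%N]) normalI_set_mod k m Q.

(* The i-th (i >= 1) positive integer congruent to r mod m, for r < m: the
   first one is r itself, except that it is m when r = 0. *)
Definition progression (m r i : nat) : nat :=
  ((if r == 0 then m else r) + (i - 1) * m)%N.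

Definition Lambda (m r : nat) (Q : nat -> nat) : nat -> nat :=
  fun i => Q (progression m r i).

(* Upsilon is the real number given by the series. The selected digits may
   eventually all be maximal, so they need not be digits (Lambda m r Q) of it. *)
Definition Upsilon (Q : nat -> nat) (m r : nat) (x : R) : R :=
  limn (cantor_partial_sum R (Lambda m r Q)
          (fun i => digits Q x (progression m r i))).

Definition normalII_set_mod_res (k m r : nat) (Q : nat -> nat) : set R :=
  [set x | normal_set k (Lambda m r Q) (Upsilon Q m r x)].

Definition normalII_set (k : nat) (Q : nat -> nat) : set R :=
  \bigcap_(r in [set r | (r < k)%N]) normalII_set_mod_res k k r Q.

Definition fully_divergentI (Q : nat -> nat) : Prop :=
  forall k m r : nat, (1 <= k)%N -> (1 <= m)%N -> (r < m)%N ->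
    expected_count_mod R Q m r k n @[n --> \oo] --> +oo.

Definition fully_divergentII (Q : nat -> nat) : Prop :=
  forall k r : nat, (1 <= k)%N -> (r < k)%N ->
    expected_count R (Lambda k r Q) k n @[n --> \oo] --> +oo.

Definition admissible (Q : nat -> nat) : Prop :=
  [/\ basic Q, infinite_in_limit Q, fully_divergentI Q & fully_divergentII Q].

End Normality.

Arguments normal_set : clear implicits.
Arguments normalI_set : clear implicits.
Arguments normalII_set : clear implicits.

(* Main.v *)
Require Import Defs.
From HB Require Import structures.
From mathcomp Require Import all_boot all_order all_algebra.
From mathcomp Require Import all_classical all_reals all_analysis.
From mathcomp Require Import zify lra.

Import Order.TTheory GRing.Theory Num.Theory.
Import numFieldNormedType.Exports.

Local Open Scope classical_set_scope.
Local Open Scope ring_scope.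

Set Implicit Arguments.
Unset Strict Implicit.
Unset Printing Implicit Defensive.

(** The inclusion is the case [m = 1], [r = 0] of the definition. The other
    claims all come from one construction, which works over any admissible [Q].

    Only fixed blocks matter, and the entries of a fixed block are eventually much
    smaller than [q_n]. So a digit sequence can consist of a large filler digit
    [q_n - 2] everywhere except on isolated copies of blocks, and the
    occurrences of a block far out are then exactly the copies of it. A copy may be
    written at consecutive positions or, more generally, with a stride [D], at
    [p, p + D, ..., p + (k - 1) D]; for the digits read along a progression modulo
    [D] such a copy is an ordinary block.

    Positions are cut into slots that hold at most one copy, and every pair of a
    block [B] and a residue [r] modulo [M] owns slots with bounded gaps. In a slot
    of its own, the pair writes a copy of [B] starting in the class of [r] whenever
    the number of copies written so far is below a prescribed expected count. As the
    increments of the expected count tend to 0 while the slots recur with bounded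
    gaps, the number of copies stays at bounded distance from the expected count
    ([greedy_count_bounded]), so their ratio tends to 1 once the expected count
    diverges. Since copies are isolated, a block occurs only boundedly many times
    with a stride [e <= k] that is not a multiple of [D] below [k D]. This is
    [block_design]. The three choices are the following.
    - Stride 1, with the whole expected count at even positions: normal of order
      [k], but not along odd positions.
    - Stride 1, equidistributed modulo [k!]: normal of type I, but each block
      occurs only boundedly often with stride [k], so not normal of type II.
    - Stride [k], equidistributed modulo [k]: normal of type II, but each block
      occurs only boundedly often at consecutive positions, so not normal of order [k].
    The two remaining claims follow from these by the inclusion.

    The digits never take the maximal value, so they are the digits of the sum of
    their series, and so are the subsequences that [Upsilon] selects
    ([digits_limn_cantor], [block_count_Upsilon]). An admissible [Q] is obtained from
    the largest [b] with [b ^ b <= n]: products of a bounded number of neighbouring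
    values are eventually at most linear in [n], so all sums of expected
    frequencies dominate a harmonic series. *)

(** * Ratios of sequences at bounded distance *)

Lemma cvg_bounded_over_pinfty (R : realType) (a b : nat -> R) (C : R) :
  (forall n, `|a n| <= C) -> b n @[n --> \oo] --> +oo ->
  a n / b n @[n --> \oo] --> (0 : R).
Proof.
move=> aC /cvgryPge boo; apply/cvgr0Pnorm_le => e e0.
have C0 : 0 <= C by apply: le_trans (aC 0%N); exact: normr_ge0.
near=> n.
have bn : (C + 1) / e <= b n by near: n; exact: boo.
have b0 : 0 < b n by apply: lt_le_trans bn; rewrite divr_gt0 //; lra.
rewrite normrM normfV (gtr0_norm b0) ler_pdivrMr//.
move: bn; rewrite ler_pdivrMr// mulrC => bn.
by apply: le_trans (aC n) _; lra.
Unshelve. all: by end_near. Qed.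

(** Normality is always established through a bounded discrepancy between the
    actual and the expected count. *)
Lemma cvg_ratio_bounded_diff (R : realType) (a b : nat -> R) (C : R) :
  (forall n, `|a n - b n| <= C) -> b n @[n --> \oo] --> +oo ->
  a n / b n @[n --> \oo] --> (1 : R).
Proof.
move=> abC boo.
have d0 := cvg_bounded_over_pinfty abC boo.
have d1 : (a n - b n) / b n + 1 @[n --> \oo] --> (0 + 1 : R).
  by apply: cvgD => //; exact: cvg_cst.
rewrite add0r in d1; apply: cvg_trans d1; apply: near_eq_cvg.
move/cvgryPge: boo => /(_ 1) boo.
near=> n.
have b0 : 1 <= b n by near: n.
by rewrite /= mulrBl divff ?subrK// gt_eqF//; lra.
Unshelve. all: by end_near. Qed.

(** Normality fails as soon as the occurrences of a single block stay bounded
    in number while the expected count diverges. *)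
Lemma bounded_ratio_ncvg1 (R : realType) (a b : nat -> R) (C : R) :
  (forall n, `|a n| <= C) -> b n @[n --> \oo] --> +oo ->
  ~ (a n / b n @[n --> \oo] --> (1 : R)).
Proof.
move=> aC boo a1; have a0 := cvg_bounded_over_pinfty aC boo.
have /eqP : (0 : R) = 1 by exact: cvg_unique a0 a1.
by rewrite eq_sym oner_eq0.
Qed.

(** * Digits of a Cantor series *)

Definition cantor_denominator (Q : nat -> nat) (n : nat) : nat :=
  \prod_(1 <= i < n.+1) Q i.

(** The numerator of the n-th partial sum over the denominator [q_1 ... q_n]. *)
Fixpoint cantor_numerator (Q E : nat -> nat) (n : nat) : nat :=
  if n is m.+1 then (cantor_numerator Q E m * Q m.+1 + E m.+1)%N else 0%N.

Section CantorDigits.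
Variables (R : realType) (Q : nat -> nat).
Hypothesis basicQ : basic Q.

Let P (n : nat) : R := (cantor_denominator Q n)%:R.

Let P0 : P 0 = 1.
Proof. by rewrite /P /cantor_denominator big_geq. Qed.

Let PS n : P n.+1 = P n * (Q n.+1)%:R.
Proof. by rewrite /P /cantor_denominator big_nat_recr//= natrM. Qed.

Let Q_gt0 n : 0 < (Q n.+1)%:R :> R.
Proof. by rewrite ltr0n (leq_trans _ (basicQ _)). Qed.

Let P_gt0 n : 0 < P n.
Proof. by elim: n => [|n IH]; rewrite ?P0 ?ltr01// PS mulr_gt0. Qed.

Let S_0 E : cantor_partial_sum R Q E 0 = 0.
Proof. by rewrite /cantor_partial_sum big_geq. Qed.

Let S_S E n :
  cantor_partial_sum R Q E n.+1
  = cantor_partial_sum R Q E n + (E n.+1)%:R / P n.+1.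
Proof.
by rewrite /cantor_partial_sum big_nat_recr//= /P /cantor_denominator natr_prod.
Qed.

Lemma cantor_partial_sum_numerator E n :
  cantor_partial_sum R Q E n * P n = (cantor_numerator Q E n)%:R.
Proof.
elim: n => [|n IH]; first by rewrite S_0 mul0r.
by rewrite S_S mulrDl divfK ?gt_eqF// PS mulrA IH natrD natrM.
Qed.

Lemma cantor_partial_sum_nd E :
  {homo cantor_partial_sum R Q E : n m / (n <= m)%N >-> n <= m}.
Proof.
apply/nondecreasing_seqP => n.
by rewrite S_S lerDl divr_ge0// ltW.
Qed.

Let U E n : R := cantor_partial_sum R Q E n + (P n)^-1.

Let U_step E n : (E n.+1 <= Q n.+1 - 1)%N ->
  U E n.+1 <= U E n ?= iff (E n.+1 == Q n.+1 - 1)%N.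
Proof.
move=> EQ; rewrite /U S_S -addrA.
have -> : (P n)^-1 = (Q n.+1)%:R / P n.+1.
  by rewrite PS invfM mulrCA divff ?mulr1// gt_eqF.
have -> : (E n.+1)%:R / P n.+1 + (P n.+1)^-1 = (E n.+1).+1%:R / P n.+1.
  by rewrite -natr1 mulrDl mul1r.
have q2 := basicQ (ltn0Sn n).
split; first by rewrite lerD2l ler_pM2r ?invr_gt0// ler_nat; lia.
rewrite (inj_eq (addrI _)) -subr_eq0 -mulrBl mulf_eq0 invr_eq0.
rewrite (gt_eqF (P_gt0 _)) orbF subr_eq0 eqr_nat.
lia.
Qed.

(** The remainder after n terms is less than [1 / (q_1 ... q_n)], strictly
    because infinitely many digits are not maximal. *)
Lemma cantor_partial_sum_bounds E (y : R) :
  (forall n, (1 <= n)%N -> (E n <= Q n - 1)%N) ->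
  (forall n0, exists2 n, (n0 < n)%N & E n <> (Q n - 1)%N) ->
  cantor_partial_sum R Q E n @[n --> \oo] --> y ->
  forall n, cantor_partial_sum R Q E n <= y < U E n.
Proof.
move=> EQ EnQ Sy n.
have cS : cvgn (cantor_partial_sum R Q E) by apply/cvg_ex; exists y.
have yE : y = limn (cantor_partial_sum R Q E) by apply/esym/cvg_lim.
have U_ni m j : (m <= j)%N -> U E j <= U E m.
  move=> /subnK <-; elim: (j - m)%N => [//|i IH].
  by rewrite addSn; apply: le_trans IH; rewrite U_step// EQ.
have yU m : y <= U E m.
  rewrite yE; apply: limr_le => //; near=> j.
  have mj : (m <= j)%N by near: j; exact: nbhs_infty_ge.
  by apply: le_trans (U_ni _ _ mj); rewrite lerDl invr_ge0 ltW.
apply/andP; split.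
  by rewrite yE; apply: nondecreasing_cvgn_le => //; exact: cantor_partial_sum_nd.
have [[//|m] nm Em] := EnQ n.
apply: le_lt_trans (yU m.+1) _.
apply: lt_le_trans (U_ni n m nm).
by rewrite (lt_leif (U_step (EQ _ (ltn0Sn m)))); apply/eqP.
Unshelve. all: by end_near. Qed.

(** The n-th numerator is the integer part of [q_1 ... q_n * y], and consecutive
    numerators determine the digit. *)
Lemma cantor_digits_unique E E' (y : R) :
  (forall n, (1 <= n)%N -> (E n <= Q n - 1)%N) ->
  (forall n0, exists2 n, (n0 < n)%N & E n <> (Q n - 1)%N) ->
  cantor_partial_sum R Q E n @[n --> \oo] --> y ->
  (forall n, (1 <= n)%N -> (E' n <= Q n - 1)%N) ->
  (forall n0, exists2 n, (n0 < n)%N & E' n <> (Q n - 1)%N) ->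
  cantor_partial_sum R Q E' n @[n --> \oo] --> y ->
  forall n, (1 <= n)%N -> E n = E' n.
Proof.
move=> E1 E2 E3 E1' E2' E3'.
have numE F n : cantor_partial_sum R Q F n <= y < U F n ->
    Num.truncn (y * P n) = cantor_numerator Q F n.
  move=> /andP[ly yu]; apply: truncn_def.
  rewrite -cantor_partial_sum_numerator ler_pM2r// ly/= -natr1.
  rewrite -cantor_partial_sum_numerator -ltr_pdivlMr//.
  by rewrite mulrDl mulfK ?gt_eqF// mul1r.
have numEE n : cantor_numerator Q E n = cantor_numerator Q E' n.
  by rewrite -!numE//; exact: cantor_partial_sum_bounds.
case=> [//|n] _.
by have := numEE n.+1; rewrite /= numEE => /addnI.
Qed.

(** Digits avoiding the maximal value form a legitimate expansion of a number in
    [0, 1), so every such sequence is recovered from the sum of its series. *)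
Lemma digits_limn_cantor E : (forall n, (1 <= n)%N -> (E n <= Q n - 2)%N) ->
  forall n, (1 <= n)%N -> digits Q (limn (cantor_partial_sum R Q E)) n = E n.
Proof.
move=> EQ2.
have EQ n : (1 <= n)%N -> (E n <= Q n - 1)%N by move=> /EQ2; lia.
have EnQ n0 : exists2 n, (n0 < n)%N & E n <> (Q n - 1)%N.
  by exists n0.+1 => //; have := EQ2 n0.+1 isT; have := basicQ (ltn0Sn n0); lia.
have U_le n : U E n <= 1.
  elim: n => [|n IH]; first by rewrite /U S_0 P0 invr1 add0r.
  by apply: le_trans IH; rewrite U_step// EQ.
have cS : cvgn (cantor_partial_sum R Q E).
  apply: nondecreasing_is_cvgn; first exact: cantor_partial_sum_nd.
  exists 1 => _ [n _ <-]; apply: le_trans (U_le n).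
  by rewrite lerDl invr_ge0 ltW.
set y := limn _.
have yb := cantor_partial_sum_bounds EQ EnQ cS.
have fy : Num.floor y = 0.
  apply: floor_def; have := yb 0%N.
  by rewrite /U S_0 P0 invr1 !add0r.
have shift0 F : (fun n : nat => 0%:~R + cantor_partial_sum R Q F n)
    = cantor_partial_sum R Q F.
  by apply/funext => n; rewrite mulr0z add0r.
have expE : cantor_expansion Q y E by split => //; rewrite fy shift0.
have [D1 D2] : cantor_expansion Q y (digits Q y) by apply: xgetPex; exists E.
rewrite fy shift0 => D3.
exact: cantor_digits_unique D1 D2 D3 EQ EnQ cS.
Qed.

End CantorDigits.

(** * Greedy counting *)

Section Greedy.
Variables (R : realType) (O : pred nat) (w : nat -> R).

(** A copy is started at an owned position exactly when the number of copies so far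
    lags behind the target, the sum of [w] over the positions passed. *)
Fixpoint greedy_count (n : nat) : nat :=
  if n is p.+1 then
    addn (greedy_count p)
      (O p && ((greedy_count p)%:R < \sum_(0 <= t < p) w t))
  else 0%N.

Definition greedy_start (p : nat) : bool :=
  O p && ((greedy_count p)%:R < \sum_(0 <= t < p) w t).

Lemma greedy_countE n :
  greedy_count n.+1 = (\sum_(1 <= p < n.+1 | greedy_start p) 1)%N.
Proof.
elim: n => [|n IH]; first by rewrite /= [X in _ < X]big_geq// ltxx andbF big_geq.
by rewrite big_mkcond big_nat_recr//= -big_mkcond/= -IH /greedy_start; case: ifP.
Qed.

(** The count never exceeds its target by more than one. Conversely, once the
    increments of the target over a window of length [d] are at most one, an
    increment per owned position absorbs them, so a deficit stops growing. *)
Lemma greedy_count_bounded (d : nat) :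
  (forall p, 0 <= w p) -> w n @[n --> \oo] --> (0 : R) ->
  (forall P, exists2 p, (P <= p < P + d)%N & O p) ->
  exists C : R, forall n,
    `|(\sum_(1 <= p < n.+1 | greedy_start p) 1)%N%:R
      - \sum_(1 <= p < n.+1) w p| <= C.
Proof.
move=> w0 wlim Od; pose A n := \sum_(0 <= t < n) w t.
pose N := greedy_count.
have AS n : A n.+1 = A n + w n by rewrite /A big_nat_recr.
have A_nd m n : (m <= n)%N -> A m <= A n.
  move=> /subnK <-; elim: (n - m)%N => [//|i IH].
  by rewrite addSn AS; apply: le_trans IH _; rewrite lerDl.
have N_nd m n : (m <= n)%N -> (N m <= N n)%N.
  by move=> /subnK <-; elim: (n - m)%N => [//|i IH] /=; lia.
have d0 : (0 < d)%N by have [p] := Od 0%N; lia.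
have [p0 p0P] : exists p0, forall p, (p0 <= p)%N -> w p <= d%:R^-1.
  have e0 : 0 < d%:R^-1 :> R by rewrite invr_gt0 ltr0n.
  move/cvgr0Pnorm_le: wlim => /(_ _ e0)[p0 _ p0P].
  by exists p0 => p p0p; rewrite -(ger0_norm (w0 p)); exact: p0P.
have A_win p m : (p0 <= p)%N -> (m <= d)%N -> A (p + m)%N <= A p + 1.
  move=> p0p md; apply: le_trans (_ : A p + m%:R / d%:R <= _); last first.
    by rewrite lerD2l ler_pdivrMr ?ltr0n// mul1r ler_nat.
  elim: m md => [|m IH] md; first by rewrite addn0 mul0r addr0.
  rewrite addnS AS -natr1 mulrDl addrA lerD ?IH//; first lia.
  by rewrite mul1r p0P// (leq_trans p0p)// leq_addr.
have N_le n : (N n)%:R <= A n + 1.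
  elim: n => [|n IH]; first by rewrite /A big_geq//= add0r ler01.
  have wn := w0 n; rewrite /= -/N -/(A n) AS natrD.
  by case: andP => [[_ /ltW H]|_] /=; lra.
have A_le n : A n <= (N n)%:R + (A p0 + 1).
  elim/ltn_ind: n => n IH.
  have [nle|nlt] := leqP n (p0 + d).
    have := A_nd _ _ nle; have := A_win p0 d (leqnn _) (leqnn _).
    by have := ler0n R (N n); lra.
  pose P := (n - d)%N; have nP : n = (P + d)%N by rewrite /P; lia.
  have p0P' : (p0 <= P)%N by lia.
  have [p /andP[Pp pn] Op] := Od P.
  have AP : A n <= A P + 1 by rewrite nP; exact: A_win.
  have [lt|ge] := ltP (N p)%:R (A p).
    have : (N P + 1 <= N n)%N.
      have := N_nd _ _ Pp; have : (N p.+1 <= N n)%N by apply: N_nd; lia.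
      by rewrite /= -/N Op [in X in (_ + X)%N]lt /=; lia.
    rewrite -(ler_nat R) natrD => NP.
    by have := IH P ltac:(lia); lra.
  have pp : n = (p + (n - p))%N by lia.
  have : A n <= A p + 1.
    by rewrite {1}pp; apply: A_win; lia.
  have : (N p)%:R <= (N n)%:R :> R by rewrite ler_nat; apply: N_nd; lia.
  have : 0 <= A p0 by rewrite /A sumr_ge0.
  lra.
exists (A p0 + 1 + w 0%N + 1) => n.
have Asplit : \sum_(1 <= p < n.+1) w p = A n.+1 - w 0%N.
  by rewrite /A [in RHS]big_ltn// addrC addKr.
rewrite -greedy_countE Asplit -/N.
have h1 := N_le n.+1; have h2 := A_le n.+1; have h3 := w0 0%N.
have h4 : 0 <= A p0 by rewrite /A sumr_ge0.
by rewrite ler_norml; apply/andP; split; lra.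
Qed.

End Greedy.

(** Every target owns slots with bounded gaps: the target of code [i] owns those
    slots [s] for which [s + 1] has 2-adic valuation [i]. *)
Lemma recurrent_owner (T : countType) :
  exists own : nat -> option T, forall t : T,
    exists d, forall S, exists2 s, (S <= s < S + d)%N & own s = Some t.
Proof.
exists (fun s => unpickle (logn 2 s.+1)) => t.
pose i := pickle t; exists (2 ^ i.+2)%N => S.
pose v := (S %/ 2 ^ i.+1).+1.
have i0 : (0 < 2 ^ i)%N by rewrite expn_gt0.
exists (2 ^ i * (v.*2.+1)).-1; last first.
  rewrite prednK ?muln_gt0 ?i0//.
  rewrite mulnC logn_Gauss ?coprime2n//= ?odd_double//.
  by rewrite pfactorK// pickleK.
have := divn_eq S (2 ^ i.+1); have := ltn_pmod S (expn_gt0 2 i.+1).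
rewrite /v !expnS; set x := (2 ^ i)%N in i0 *; nia.
Qed.

(** * Digit sequences with prescribed block counts *)

Lemma natr_count (R : realType) (P : pred nat) n :
  (\sum_(1 <= p < n.+1 | P p) 1)%N%:R = \sum_(1 <= p < n.+1) (P p)%:R :> R.
Proof. by rewrite big_mkcond natr_sum; apply: eq_bigr => p _; case: (P p). Qed.

(** Finitely many positions change a count by a bounded amount only; this is what
    allows all statements about occurrences to hold merely at large positions. *)
Lemma sum_eventually_eq (R : realType) (f g : nat -> R) (N0 : nat) :
  (forall p, (N0 <= p)%N -> f p = g p) ->
  exists C : R, forall n,
    `|\sum_(1 <= p < n.+1) f p - \sum_(1 <= p < n.+1) g p| <= C.
Proof.
move=> fg; pose h p := `|f p - g p|.
have h0 p : 0 <= h p by exact: normr_ge0.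
exists (\sum_(0 <= p < N0) h p) => n.
rewrite -sumrB; apply: le_trans (ler_norm_sum _ _ _) _.
apply: le_trans (_ : \sum_(0 <= p < n.+1) h p <= _).
  by rewrite [leRHS]big_ltn// lerDr.
have [le|lt] := leqP n.+1 N0.
  by rewrite [leRHS](big_cat_nat _ le)//= lerDl sumr_ge0.
rewrite (big_cat_nat _ (ltnW lt))//= [X in _ + X]big1_seq ?addr0// => p.
by rewrite mem_index_iota => /andP[_ /andP[/fg fgp _]]; rewrite /h fgp subrr normr0.
Qed.

(** Stride 1 is an ordinary occurrence; stride [m] is an occurrence in the digits
    read along a progression modulo [m]. *)
Definition occurs_stride (k : nat) (B : k.-tuple nat) (E : nat -> nat)
    (e p : nat) : bool :=
  [forall i : 'I_k, E (p + e * i)%N == tnth B i].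

Section BlockDesign.
Variables (R : realType) (k : nat) (Q : nat -> nat) (D M : nat).
Variable w : nat -> nat -> R.
Hypotheses (k_gt1 : (1 < k)%N) (D_gt0 : (0 < D)%N) (Dk : (D <= k)%N).
Hypothesis M_gt0 : (0 < M)%N.
Hypothesis Qoo : infinite_in_limit Q.
Hypothesis w_ge0 : forall r p, 0 <= w r p.
Hypothesis w_lim : forall r, w r n @[n --> \oo] --> (0 : R).

Let target : countType := (k.-tuple nat * 'I_M)%type.
Variable own : nat -> option target.
Hypothesis own_recurrent : forall t : target,
  exists d, forall S, exists2 s, (S <= s < S + d)%N & own s = Some t.

(** Long enough for a copy of a block, in any residue class modulo [M], followed
    by a gap longer than the span of any occurrence of a block with stride at
    most [k]. *)
Let L := (M * (1 + 2 * (k * k)))%N.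

Definition owned_position (t : target) : pred nat :=
  fun p => (own (p %/ L) == Some t) && (p %% L == t.2 :> nat)%N.

Definition copy_start (t : target) : pred nat :=
  greedy_start (owned_position t) (w t.2).

(** The filler [Q n - 2] tends to infinity, hence differs from every entry of a
    given block at all large positions, and is not the maximal digit. *)
Definition design_digit (n : nat) : nat :=
  if own (n %/ L) is Some t then
    let p := (n %/ L * L + t.2)%N in
    let j := ((n - p) %/ D)%N in
    if [&& copy_start t p, n == (p + D * j)%N & (j < k)%N]
    then minn (nth 0%N t.1 j) (Q n - 2) else (Q n - 2)%N
  else (Q n - 2)%N.

Let M_le (t : target) : (t.2 < M)%N. Proof. exact: ltn_ord. Qed.

Let L_ge : (M + 2 * (k * k) <= L)%N.
Proof. by rewrite /L; nia. Qed.

Let L_gt0 : (0 < L)%N. Proof. by move: L_ge; lia. Qed.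

Let mod_slot s (t : target) : ((s * L + t.2) %% M)%N = t.2.
Proof. by rewrite /L mulnCA mulnC modnMDl modn_small. Qed.

Lemma copy_start_owned t p :
  copy_start t p -> own (p %/ L) = Some t /\ p = (p %/ L * L + t.2)%N.
Proof.
by move=> /andP[/andP[/eqP H1 /eqP H2] _]; split; rewrite // -H2 -divn_eq.
Qed.

Let copy_div t p i : copy_start t p -> (i < k)%N -> ((p + D * i) %/ L = p %/ L)%N.
Proof.
move=> /copy_start_owned[_ pE] ik.
have lt : (t.2 + D * i < L)%N.
  have := M_le t; have := L_ge; have : (D * i <= k * k)%N by nia.
  lia.
by rewrite {1}pE -addnA divnMDl// (divn_small lt) addn0.
Qed.

Lemma design_digit_copy t p i : copy_start t p -> (i < k)%N ->
  design_digit (p + D * i) = minn (nth 0%N t.1 i) (Q (p + D * i) - 2).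
Proof.
move=> cs ik; have [ow pE] := copy_start_owned cs.
rewrite /design_digit (copy_div cs ik) ow -pE.
by rewrite (addKn p) mulKn// eqxx ik cs.
Qed.

Lemma design_digit_small n : (design_digit n < Q n - 2)%N ->
  exists t p i, [/\ copy_start t p, (i < k)%N & n = (p + D * i)%N].
Proof.
rewrite /design_digit; case: (own _) => [t|]; last by rewrite ltnn.
case: ifP => [/and3P[cs /eqP nE ik] _|_]; last by rewrite ltnn.
by do 3 eexists; split; [exact: cs|exact: ik|exact: nE].
Qed.

Lemma design_digit_le n : (design_digit n <= Q n - 2)%N.
Proof.
rewrite /design_digit; case: (own _) => [t|//].
by case: ifP => // _; rewrite geq_minr.
Qed.

(** Two positions of copies at distance at most [k * k] lie in the same slot, and
    a slot holds a single copy. *)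
Lemma copy_isolated t p i t' p' i' :
  copy_start t p -> copy_start t' p' -> (i < k)%N -> (i' < k)%N ->
  (p + D * i <= p' + D * i' <= p + D * i + k * k)%N -> t = t' /\ p = p'.
Proof.
move=> cs cs' ik ik' /andP[le1 le2].
have [ow pE] := copy_start_owned cs; have [ow' pE'] := copy_start_owned cs'.
have Di : (D * i <= k * k)%N by nia.
have := copy_div cs ik; have := copy_div cs' ik'.
set s := (p %/ L)%N in ow pE *; set s' := (p' %/ L)%N in ow' pE' *.
move=> d' d.
have ss' : (s <= s')%N by rewrite -d -d' leq_div2r.
have s's : (s' <= s)%N.
  rewrite leqNgt; apply/negP => lt.
  have : (s.+1 * L <= s' * L)%N by rewrite leq_mul2r lt orbT.
  by have := L_ge; have := M_le t; rewrite mulSn; lia.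
have sE : s = s' by apply/eqP; rewrite eqn_leq ss'.
have tt : t = t' by move: ow; rewrite sE ow' => -[].
by split => //; rewrite pE pE' sE tt.
Qed.

Let entries_eventually_small (B : k.-tuple nat) :
  exists N0, forall n i, (N0 <= n)%N -> (tnth B i < Q n - 2)%N.
Proof.
pose b := (\max_i tnth B i)%N.
move/cvgnyPge: Qoo => /(_ (b + 3)%N)[N0 _ N0P].
exists N0 => n i le; have /= := N0P n le.
by have : (tnth B i <= b)%N by [exact: leq_bigmax]; lia.
Qed.

Let occurs_small (B : k.-tuple nat) N0 e p i :
  (forall n i, (N0 <= n)%N -> (tnth B i < Q n - 2)%N) -> (N0 <= p)%N ->
  occurs_stride B design_digit e p -> (i < k)%N ->
  exists t p' i', [/\ copy_start t p', (i' < k)%N & (p + e * i = p' + D * i')%N].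
Proof.
move=> N0P le /forallP occ ik; apply: design_digit_small.
have /eqP -> := occ (Ordinal ik); apply: N0P.
by rewrite (leq_trans le) ?leq_addr.
Qed.

(** Far out, an occurrence with stride [D] spans a single copy, so it starts where the
    copy starts and the copy is one of the same block. *)
Lemma occurs_design (B : k.-tuple nat) :
  exists N0, forall p, (N0 <= p)%N ->
    occurs_stride B design_digit D p
    = copy_start (B, Ordinal (ltn_pmod p M_gt0)) p.
Proof.
have [N0 N0P] := entries_eventually_small B; exists N0 => p le.
apply/idP/idP => [occ|cs]; last first.
  apply/forallP => i; rewrite (design_digit_copy cs)//= -tnth_nth.
  by apply/eqP/minn_idPl/ltnW/N0P; rewrite (leq_trans le) ?leq_addr.
(* The first and the last position of the occurrence are at distance at most
   k * k, hence belong to the same copy. *)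
have k1 : (k.-1 < k)%N by lia.
have [t [q [a [cs ak pE]]]] := occurs_small N0P le occ (ltnW k_gt1).
have [t' [q' [b [cs' bk pE']]]] := occurs_small N0P le occ k1.
rewrite muln0 addn0 in pE.
have Dk1 : (D * k.-1 <= k * k)%N by apply: leq_mul => //; exact: leq_pred.
have [tt qq] : t = t' /\ q = q'.
  by apply: copy_isolated cs cs' ak bk _; apply/andP; split; lia.
subst t' q'.
have a0 : a = 0%N.
  have : (D * (a + k.-1) = D * b)%N by rewrite mulnDr; lia.
  by move/eqP; rewrite eqn_pmul2l// => /eqP; lia.
have pq : p = q by rewrite pE a0 muln0 addn0.
subst q; suff -> : (B, Ordinal (ltn_pmod p M_gt0)) = t by [].
have [_ pM] := copy_start_owned cs.
rewrite [t]surjective_pairing; congr pair.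
  apply/eq_from_tnth => i; move/forallP: (occ) => /(_ i)/eqP <-.
  rewrite (design_digit_copy cs)// -tnth_nth.
  apply/minn_idPl; rewrite leqNgt; apply/negP => lt.
  move/forallP: occ => /(_ i); rewrite (design_digit_copy cs)// -tnth_nth.
  have := N0P (p + D * i)%N i (leq_trans le (leq_addr _ _)).
  by move: lt; rewrite /minn => lt; case: ifP => //; lia.
by apply/val_inj; rewrite /= [in LHS]pM mod_slot.
Qed.

(** Far out, each occurrence with stride [D] in the class of [r] is a copy started
    in exactly one of the classes modulo [M] that refine it, so the bounds
    for the greedy counts of these classes add up. *)
Lemma occurs_design_mod (B : k.-tuple nat) (m r : nat) : (m %| M)%N ->
  exists C : R, forall n,
    `|(\sum_(1 <= p < n.+1 |
         (p == r %[mod m]) && occurs_stride B design_digit D p) 1)%N%:R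
      - \sum_(1 <= p < n.+1) \sum_(r' < M | r' == r %[mod m]) w r' p| <= C.
Proof.
move=> mM; have [N0 N0P] := occurs_design B.
have startM (r' : 'I_M) p : copy_start (B, r') p -> (p %% M)%N = r'.
  by move=> /copy_start_owned[_ ->]; rewrite mod_slot.
have [C1 C1P] : exists C : R, forall n,
    `|\sum_(1 <= p < n.+1)
        ((p == r %[mod m]) && occurs_stride B design_digit D p)%:R
      - \sum_(1 <= p < n.+1) \sum_(r' < M | r' == r %[mod m])
          (copy_start (B, r') p)%:R| <= C.
  apply: (@sum_eventually_eq _ _ _ N0) => p /N0P ->.
  have [cs|ncs] := boolP (copy_start _ p); last first.
    rewrite andbF big1// => r' _; case: (boolP (copy_start _ _)) => // cs.
    case/negP: ncs; suff -> : Ordinal (ltn_pmod p M_gt0) = r' by [].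
    by apply/val_inj; exact: startM.
  rewrite andbT big_mkcond (bigD1 (Ordinal (ltn_pmod p M_gt0)))//= cs.
  rewrite big1 => [|r' r'p]; first by rewrite modn_dvdm// addr0; case: ifP.
  case: ifP => // _; case: (boolP (copy_start _ _)) => // /startM pr'.
  by case/negP: r'p; apply/eqP/val_inj.
have C2 (r' : 'I_M) : exists C : R, forall n,
    `|\sum_(1 <= p < n.+1) (copy_start (B, r') p)%:R
      - \sum_(1 <= p < n.+1) w r' p| <= C.
  have [d dP] := own_recurrent (B, r').
  have [] := @greedy_count_bounded R (owned_position (B, r')) (w r') (d.+2 * L)%N.
  - exact: w_ge0.
  - exact: w_lim.
  - move=> P; have [s /andP[sP Ps] os] := dP (P %/ L).+1.
    have rL : (r' < L)%N by apply: leq_trans (ltn_ord r') _; move: L_ge; lia.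
    exists (s * L + r')%N; last first.
      by rewrite /owned_position divnMDl// divn_small// addn0 os modnMDl modn_small ?eqxx.
    have := divn_eq P L; have := ltn_pmod P L_gt0.
    set x := (P %/ L)%N in sP Ps *.
    have : (x.+1 * L <= s * L)%N by rewrite leq_mul2r sP orbT.
    have : (s * L <= (x + d.+1) * L)%N by rewrite leq_mul2r; apply/orP; right; lia.
    rewrite !mulnDl !mulSn; lia.
  by move=> C CP; exists C => n; rewrite -natr_count; exact: CP.
have [C2f C2P] := choice C2.
exists (C1 + \sum_(r' < M | r' == r %[mod m]) C2f r') => n.
rewrite natr_count.
have := C1P n; set X := \sum_(1 <= p < n.+1) _; set Y := \sum_(1 <= p < n.+1) _.
move=> XY; rewrite -(subrK Y X) -addrA.
apply: le_trans (ler_normD _ _) _; apply: lerD => //.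
rewrite /Y exchange_big/= [X in _ - X]exchange_big/= -sumrB.
by apply: le_trans (ler_norm_sum _ _ _) _; apply: ler_sum => r' _; exact: C2P.
Qed.

(** Far out, the first two entries of an occurrence with stride [e] would both lie
    in one copy, so [e] would be a multiple of [D] less than [k * D]. *)
Lemma occurs_design_other_stride (B : k.-tuple nat) (e : nat) :
  (0 < e <= k)%N -> (forall a, (a < k)%N -> e <> (D * a)%N) ->
  exists C : R, forall n,
    `|(\sum_(1 <= p < n.+1 | occurs_stride B design_digit e p) 1)%N%:R| <= C.
Proof.
move=> /andP[e0 ek] eD; have [N0 N0P] := entries_eventually_small B.
have [C CP] : exists C : R, forall n,
    `|\sum_(1 <= p < n.+1) (occurs_stride B design_digit e p)%:R
      - \sum_(1 <= p < n.+1) 0| <= C.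
  apply: (@sum_eventually_eq _ _ _ N0) => p le.
  case: (boolP (occurs_stride _ _ _ _)) => // occ.
  have [t [q [a [cs ak pE]]]] := occurs_small N0P le occ (ltnW k_gt1).
  have [t' [q' [b [cs' bk pE']]]] := occurs_small N0P le occ k_gt1.
  rewrite muln0 addn0 in pE; rewrite muln1 in pE'.
  have [tt qq] : t = t' /\ q = q'.
    by apply: copy_isolated cs cs' ak bk _; apply/andP; split; nia.
  subst t' q'; case: (eD (b - a)%N); first lia.
  by rewrite mulnBr; lia.
by exists C => n; have := CP n; rewrite natr_count big1_eq subr0.
Qed.

End BlockDesign.

(** Block occurrences with stride [D] can be given any slowly accumulating
    expected counts in all residue classes at once, without creating infinitely
    many occurrences of a block with another stride. *)
Lemma block_design (R : realType) (k : nat) (Q : nat -> nat) (D M : nat)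
    (w : nat -> nat -> R) :
  (1 < k)%N -> (0 < D <= k)%N -> (0 < M)%N -> infinite_in_limit Q ->
  (forall r p, 0 <= w r p) -> (forall r, w r n @[n --> \oo] --> (0 : R)) ->
  exists E : nat -> nat, [/\
    forall n, (E n <= Q n - 2)%N,
    forall (B : k.-tuple nat) m r, (m %| M)%N -> exists C : R, forall n,
      `|(\sum_(1 <= p < n.+1 |
           (p == r %[mod m]) && occurs_stride B E D p) 1)%N%:R
        - \sum_(1 <= p < n.+1) \sum_(r' < M | r' == r %[mod m]) w r' p| <= C &
    forall (B : k.-tuple nat) e, (0 < e <= k)%N ->
      (forall a, (a < k)%N -> e <> (D * a)%N) -> exists C : R, forall n,
      `|(\sum_(1 <= p < n.+1 | occurs_stride B E e p) 1)%N%:R| <= C].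
Proof.
move=> k1 /andP[D0 Dk] M0 Qoo w0 wlim.
have [own ownP] := recurrent_owner (k.-tuple nat * 'I_M)%type.
exists (design_digit Q D w own); split.
- exact: design_digit_le.
- by move=> B m r mM; exact: occurs_design_mod.
- by move=> B e; exact: occurs_design_other_stride.
Qed.

(** * Sums along arithmetic progressions *)

Lemma progressionD (m r i j : nat) : (0 < i)%N ->
  progression m r (i + j) = (progression m r i + m * j)%N.
Proof.
case: i => [//|i] _.
by rewrite /progression addSn !subn1 /= mulnDl addnA (mulnC m).
Qed.

Lemma progression_gt0 (m r i : nat) : (0 < m)%N -> (0 < progression m r i)%N.
Proof. by rewrite addn_gt0; case: r => [|r] //= ->. Qed.

Lemma progression_mod (m r i : nat) : progression m r i = r %[mod m].
Proof.
rewrite /progression addnC modnMDl.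
by case: eqP => [->|//]; rewrite modnn mod0n.
Qed.

(** The window of [m] positions after [n * m] contains one term of the
    progression, the one of index [n + 1]. *)
Lemma sum_progression (V : nmodType) (g : nat -> V) (m r n : nat) : (r < m)%N ->
  \sum_(1 <= p < (n * m).+1 | p == r %[mod m]) g p
  = \sum_(1 <= i < n.+1) g (progression m r i).
Proof.
move=> rm; elim: n => [|n IH]; first by rewrite mul0n !big_geq.
rewrite big_nat_recr//= -IH (@big_cat_nat _ _ _ (n * m).+1)//=; last first.
  by rewrite ltnS leq_mul2r leqnSn orbT.
congr (_ + _).
have pn : ((n * m).+1 <= progression m r n.+1 < (n.+1 * m).+1)%N.
  by rewrite /progression subn1 /= mulSn; case: eqP => /=; lia.
pose a := (n * m).+1%N.
have modE p : (a <= p < (n.+1 * m).+1)%N ->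
    (p == r %[mod m]) = (p == progression m r n.+1).
  move=> ap; rewrite -(progression_mod m r n.+1).
  have [u um pE] : exists2 u, (u < m)%N & p = (a + u)%N.
    by exists (p - a)%N; rewrite /a in ap *; move: ap; rewrite mulSn; lia.
  have [v vm ->] : exists2 v, (v < m)%N & progression m r n.+1 = (a + v)%N.
    exists (progression m r n.+1 - a)%N; move: pn; rewrite /a mulSn; lia.
  by rewrite pE eqn_modDl eqn_add2l !modn_small.
rewrite big_mkcond/= (eq_big_nat _ _ (fun p ap => congr1 (fun c => if c then g p else 0) (modE p ap))).
by rewrite -big_mkcond big_nat1_eq pn.
Qed.

(** * A slowly growing basic sequence *)

(** Growing this slowly, [b ^ k <= b ^ b <= n] holds eventually for every fixed
    [k]; the lower bound 2 makes the sequence basic. *)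
Definition slow_base (n : nat) : nat :=
  maxn 2 (\max_(b < n.+1 | (b ^ b <= n)%N) b).

Lemma slow_base_ge2 n : (2 <= slow_base n)%N.
Proof. exact: leq_maxl. Qed.

Lemma leq_slow_base b n : (b ^ b <= n)%N -> (b <= slow_base n)%N.
Proof.
move=> bn; have bn1 : (b < n.+1)%N.
  case: b bn => [//|[|b]] bn; first by move: bn; rewrite expn1.
  by rewrite ltnS (leq_trans _ bn)// ltnW// ltn_expl.
rewrite /slow_base leq_max; apply/orP; right.
exact: (leq_bigmax_cond (Ordinal bn1)).
Qed.

Lemma slow_base_exp n : (4 <= n)%N -> (slow_base n ^ slow_base n <= n)%N.
Proof.
move=> n4; rewrite /slow_base.
set m := (\max_(_ < _ | _) _)%N.
have mn : (m ^ m <= n)%N.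
  apply: (big_ind (fun x => (x ^ x <= n)%N)) => [|x y xn yn|//].
    by rewrite expn0; lia.
  by rewrite /maxn; case: ifP.
by rewrite /maxn; case: ifP.
Qed.

Lemma slow_base_homo n m : (n <= m)%N -> (slow_base n <= slow_base m)%N.
Proof.
move=> nm; have [n4|n4] := leqP 4 n.
  by apply: leq_slow_base; apply: leq_trans nm; exact: slow_base_exp.
suff -> : slow_base n = 2%N by exact: slow_base_ge2.
rewrite /slow_base; apply/maxn_idPl/bigmax_leqP => b bn.
rewrite leqNgt; apply/negP => b2.
have : (2 ^ 2 <= b ^ b)%N.
  by apply: leq_trans (_ : 2 ^ b <= _)%N; [rewrite leq_exp2l// ltnW|rewrite leq_exp2r; lia].
by lia.
Qed.

Lemma slow_base_infinite_in_limit : infinite_in_limit slow_base.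
Proof.
apply/cvgnyPge => A; exists (A ^ A)%N => // n /= An.
exact: leq_slow_base.
Qed.

(** The probability of a given block at position [p], read with stride [e], when
    the digits are independent and uniformly distributed. *)
Definition stride_weight (R : realType) (Q : nat -> nat) (e k p : nat) : R :=
  (\prod_(j < k) (Q (p + e * j)%N)%:R)^-1.

(** For large [p] the product is at most [slow_base (p + e * k)] to the power of
    itself, hence at most [p + e * k]. *)
Lemma slow_base_prod_le (e k : nat) : exists C, forall p,
  (\prod_(j < k) slow_base (p + e * j) <= C * p.+1)%N.
Proof.
pose P0 := (maxn 4 (k ^ k))%N; pose d := (e * k)%N.
exists (slow_base (P0 + d) ^ k + d.+1)%N => p.
have prod_le : (\prod_(j < k) slow_base (p + e * j) <= slow_base (p + d) ^ k)%N.
  rewrite -[in leqRHS](card_ord k) -prod_nat_const.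
  by apply: leq_prod => j _; apply: slow_base_homo; rewrite leq_add2l leq_mul2l ltnW ?orbT.
apply: leq_trans prod_le _.
have [pP|Pp] := leqP p P0.
  apply: leq_trans (_ : slow_base (P0 + d) ^ k * p.+1 <= _)%N; last first.
    by rewrite leq_mul2r leq_addr orbT.
  apply: leq_trans (leq_pmulr _ _) => //; move: (k) => j.
  elim: j => [//|j IH]; rewrite !expnS leq_mul// slow_base_homo//.
  by rewrite leq_add2r.
apply: leq_trans (_ : p + d <= _)%N; last by nia.
have [p4 pk] : (4 <= p)%N /\ (k ^ k <= p)%N.
  by move: Pp; rewrite /P0 gtn_max => /andP[]; lia.
apply: leq_trans (slow_base_exp (leq_trans p4 (leq_addr d p))).
rewrite leq_exp2l; last by rewrite slow_base_ge2.
by apply: leq_slow_base; rewrite (leq_trans pk)// leq_addr.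
Qed.

Lemma stride_weight_ge0 (R : realType) (Q : nat -> nat) e k p :
  0 <= stride_weight R Q e k p.
Proof. by rewrite invr_ge0 prodr_ge0. Qed.

Lemma stride_weight_cvg0 (R : realType) (Q : nat -> nat) e k :
  (0 < k)%N -> basic Q -> infinite_in_limit Q ->
  stride_weight R Q e k p @[p --> \oo] --> (0 : R).
Proof.
case: k => [//|k] _ bQ Qoo; apply/cvgr0Pnorm_le => eps eps0.
pose A := (Num.truncn eps^-1).+1.
move/cvgnyPge: Qoo => /(_ A)[N0 _ N0P].
exists N0.+1 => // p /= Np; rewrite ger0_norm ?stride_weight_ge0//.
have Ap : (A <= \prod_(j < k.+1) Q (p + e * j))%N.
  rewrite big_ord_recl/= muln0 addn0.
  apply: leq_trans (leq_pmulr _ _); first exact/N0P/ltnW.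
  by rewrite prodn_gt0// => j; rewrite (leq_trans _ (bQ _ _))//; lia.
rewrite /stride_weight -natr_prod.
rewrite invf_ple ?posrE//; last by rewrite ltr0n (leq_trans _ Ap).
rewrite -(ler_nat R) in Ap.
by apply: le_trans Ap; apply/ltW/truncnS_gt.
Qed.

Definition residue_weight (R : realType) (Q : nat -> nat) (e k M r p : nat) : R :=
  if p == r %[mod M] then stride_weight R Q e k p else 0.

Lemma residue_weight_ge0 (R : realType) (Q : nat -> nat) e k M r p :
  0 <= residue_weight R Q e k M r p.
Proof.
by rewrite /residue_weight; case: ifP => // _; exact: stride_weight_ge0.
Qed.

Lemma residue_weight_cvg0 (R : realType) (Q : nat -> nat) e k M r :
  (0 < k)%N -> basic Q -> infinite_in_limit Q ->
  residue_weight R Q e k M r p @[p --> \oo] --> (0 : R).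
Proof.
move=> k0 bQ Qoo.
apply: (@squeeze_cvgr _ _ _ _ (fun=> 0) (stride_weight R Q e k)) => //;
  [|exact: cvg_cst|exact: stride_weight_cvg0].
apply: nearW => p; rewrite residue_weight_ge0/= /residue_weight.
by case: ifP => // _; exact: stride_weight_ge0.
Qed.

Lemma harmonic_minorant_dvg (R : realType) (f : nat -> R) (c : R) : 0 < c ->
  (forall i, (0 < i)%N -> c / i.+1%:R <= f i) ->
  \sum_(1 <= i < n.+1) f i @[n --> \oo] --> +oo.
Proof.
move=> c0 cf.
have nd : {homo series (@harmonic R) : n m / (n <= m)%N >-> n <= m}.
  by apply: nondecreasing_series => i _ _; exact: harmonic_ge0.
have /cvgryPge hoo := nondecreasing_dvgn_lt nd (@dvg_harmonic R).
apply/cvgryPge => A; near=> n.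
have : A / c + 1 <= series (@harmonic R) n by near: n; exact: hoo.
have := nd _ _ (leqnSn n).
rewrite [series _ n.+1]/series/= big_ltn// /harmonic/= invr1 => h1 h2.
have : A <= c * \sum_(1 <= i < n.+1) i.+1%:R^-1.
  by rewrite mulrC -ler_pdivrMr//; lra.
move=> /le_trans; apply; rewrite mulr_sumr.
by apply: ler_sum_nat => i /andP[i0 _]; exact: cf.
Unshelve. all: by end_near. Qed.

(** The weight at the i-th term of a progression is at least a constant multiple
    of [1 / (i + 1)]. *)
Lemma slow_stride_weight_dvg (R : realType) (m r e k : nat) : (r < m)%N ->
  \sum_(1 <= i < n.+1) stride_weight R slow_base e k (progression m r i)
    @[n --> \oo] --> +oo.
Proof.
move=> rm; have [C CP] := slow_base_prod_le e k.
have m0 : (0 < m)%N by lia.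
apply: (@harmonic_minorant_dvg _ _ (C.+1 * m)%N%:R^-1).
  by rewrite invr_gt0 ltr0n muln_gt0.
move=> i i0; rewrite /stride_weight -natr_prod -invfM -natrM.
rewrite lef_pV2 ?posrE ?ltr0n ?muln_gt0 ?m0 ?prodn_gt0//; last first.
  by move=> j; rewrite (leq_trans _ (slow_base_ge2 _)).
rewrite ler_nat; apply: leq_trans (CP _) _.
have prog_le : (progression m r i <= i * m)%N.
  case: (i) i0 => [//|j] _; rewrite /progression subn1 mulSn leq_add2r.
  by case: ifP => // _; exact: ltnW.
by rewrite -mulnA leq_mul// mulnC mulSn; lia.
Qed.

(** * Counts in terms of strides *)

Lemma expected_countE (R : realType) (Q : nat -> nat) k n :
  expected_count R Q k n = \sum_(1 <= p < n.+1) stride_weight R Q 1 k p.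
Proof.
apply: eq_bigr => p _; congr (_^-1).
rewrite -{1}[p]add0n big_addn addKn big_mkord.
by apply: eq_bigr => j _; rewrite mul1n addnC.
Qed.

Lemma expected_count_modE (R : realType) (Q : nat -> nat) m r k n :
  expected_count_mod R Q m r k n
  = \sum_(1 <= p < n.+1 | p == r %[mod m]) stride_weight R Q 1 k p.
Proof.
apply: eq_bigr => p _; congr (_^-1).
rewrite -{1}[p]add0n big_addn addKn big_mkord.
by apply: eq_bigr => j _; rewrite mul1n addnC.
Qed.

Lemma expected_count_Lambda (R : realType) (Q : nat -> nat) m r k n :
  expected_count R (Lambda m r Q) k n
  = \sum_(1 <= i < n.+1) stride_weight R Q m k (progression m r i).
Proof.
rewrite expected_countE; apply: eq_big_nat => i /andP[i0 _].
congr (_^-1); apply: eq_bigr => j _.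
by rewrite mul1n /Lambda progressionD.
Qed.

Lemma admissible_slow_base (R : realType) : admissible R slow_base.
Proof.
split.
- by move=> n _; exact: slow_base_ge2.
- exact: slow_base_infinite_in_limit.
- move=> k m r _ m0 rm; rewrite (_ : expected_count_mod _ _ _ _ _ =
    fun n => \sum_(1 <= p < n.+1 | p == r %[mod m])
               stride_weight R slow_base 1 k p); last first.
    by apply/funext => n; exact: expected_count_modE.
  have := @slow_stride_weight_dvg R _ _ 1 k rm.
  move/cvgryPge => oo; apply/cvgryPge => A.
  have [n0 _ /(_ n0 (leqnn _))/= n0A] := oo A.
  exists (n0 * m)%N => // n /= le.
  apply: le_trans n0A _; rewrite -sum_progression//.
  rewrite [leRHS](@big_cat_nat _ _ _ (n0 * m).+1)//= lerDl.
  by apply: sumr_ge0 => p _; exact: stride_weight_ge0.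
- move=> k r _ rk; rewrite (_ : expected_count _ _ _ = fun n =>
    \sum_(1 <= i < n.+1) stride_weight R slow_base k k (progression k r i)).
    exact: slow_stride_weight_dvg.
  by apply/funext => n; exact: expected_count_Lambda.
Qed.

Section CountsOfSeries.
Variables (R : realType) (Q E : nat -> nat).
Hypothesis basicQ : basic Q.
Hypothesis EQ : forall n, (E n <= Q n - 2)%N.

Let x : R := limn (cantor_partial_sum R Q E).

Let digits_x n : (0 < n)%N -> digits Q x n = E n.
Proof. by apply: digits_limn_cantor. Qed.

Let occurs_atE k (B : k.-tuple nat) p : (0 < p)%N ->
  occurs_at B (digits Q x) p = occurs_stride B E 1 p.
Proof.
move=> p0; apply: eq_forallb => i.
by rewrite mul1n digits_x// addn_gt0 p0.
Qed.

Lemma block_countE k (B : k.-tuple nat) n :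
  block_count Q B x n = (\sum_(1 <= p < n.+1 | occurs_stride B E 1 p) 1)%N.
Proof.
rewrite /block_count big_mkcond [RHS]big_mkcond.
by apply: eq_big_nat => p /andP[p0 _]; rewrite occurs_atE.
Qed.

Lemma block_count_modE m r k (B : k.-tuple nat) n :
  block_count_mod Q m r B x n
  = (\sum_(1 <= p < n.+1 | (p == r %[mod m]) && occurs_stride B E 1 p) 1)%N.
Proof.
rewrite /block_count_mod big_mkcond [RHS]big_mkcond.
by apply: eq_big_nat => p /andP[p0 _]; rewrite occurs_atE.
Qed.

(** Selecting the digits along a progression again avoids the maximal digits, so
    they are the digits of [Upsilon], and blocks in them are blocks with
    stride [m]. *)
Lemma block_count_Upsilon m r k (B : k.-tuple nat) n : (r < m)%N ->
  block_count (Lambda m r Q) B (Upsilon Q m r x) n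
  = (\sum_(1 <= p < (n * m).+1 |
       (p == r %[mod m]) && occurs_stride B E m p) 1)%N.
Proof.
move=> rm; have m0 : (0 < m)%N by lia.
have UE : Upsilon Q m r x
    = limn (cantor_partial_sum R (Lambda m r Q) (E \o progression m r)).
  apply: (congr1 (fun u : nat -> R => limn u)); apply/funext => i; apply: eq_big_nat => j /andP[j0 _].
  by rewrite digits_x// progression_gt0.
have digU i : (0 < i)%N ->
    digits (Lambda m r Q) (Upsilon Q m r x) i = E (progression m r i).
  rewrite UE => i0; rewrite digits_limn_cantor//.
    by move=> j j0; apply: basicQ; exact: progression_gt0.
  by move=> j _; exact: EQ.
rewrite big_mkcondr/= sum_progression// /block_count big_mkcond.
apply: eq_big_nat => i /andP[i0 _].
congr (if _ then _ else _); apply: eq_forallb => j.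
by rewrite digU ?addn_gt0 ?i0// progressionD.
Qed.

End CountsOfSeries.

Lemma sum_residue_indicator (V : nmodType) (M m r p : nat) (v : V) :
  (0 < M)%N -> (m %| M)%N ->
  \sum_(r' < M | r' == r %[mod m]) (if p == r' %[mod M] then v else 0)
  = if p == r %[mod m] then v else 0.
Proof.
move=> M0 mM; rewrite big_mkcond (bigD1 (Ordinal (ltn_pmod p M0)))//=.
rewrite modn_mod eqxx modn_dvdm// big1 ?addr0// => r' r'p.
case: ifP => // _; case: ifP => // /eqP pr'.
case/negP: r'p; apply/eqP/val_inj => /=.
by rewrite pr' modn_small.
Qed.

Lemma sum_residue_weight (R : realType) (Q : nat -> nat) e k M m r n :
  (0 < M)%N -> (m %| M)%N ->
  \sum_(1 <= p < n.+1) \sum_(r' < M | r' == r %[mod m])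
    residue_weight R Q e k M r' p
  = \sum_(1 <= p < n.+1 | p == r %[mod m]) stride_weight R Q e k p.
Proof.
move=> M0 mM; rewrite [RHS]big_mkcond; apply: eq_bigr => p _.
exact: sum_residue_indicator.
Qed.

(** * The inclusion and the separations *)

Lemma normalI_sub_normal (R : realType) (k : nat) (Q : nat -> nat) :
  (0 < k)%N -> normalI_set R k Q `<=` normal_set R k Q.
Proof.
move=> k0 x /(_ 1%N k0 0%N isT) xI B; have := xI B.
rewrite (_ : block_count_mod Q 1 0 B x = block_count Q B x).
  rewrite (_ : expected_count_mod R Q 1 0 k = expected_count R Q k)//.
  by apply/funext => n; apply: eq_bigl => p; rewrite !modn1.
by apply/funext => n; apply: eq_bigl => p; rewrite !modn1.
Qed.

(** Copies at consecutive positions that all start at even positions and make up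
    for the whole expected count: odd positions start only boundedly many
    occurrences. *)
Lemma normal_not_normalI (R : realType) (k : nat) (Q : nat -> nat) :
  (1 < k)%N -> admissible R Q ->
  ~ (normal_set R k Q `<=` normalI_set R k Q).
Proof.
move=> k1 [bQ Qoo fI fII] sub.
pose w (r p : nat) := if r == 0%N then stride_weight R Q 1 k p else 0.
have [||E [EQ EM _]] := @block_design R k Q 1 2 w k1 (ltnW k1) isT Qoo.
- by move=> r p; rewrite /w; case: ifP => // _; exact: stride_weight_ge0.
- move=> r; rewrite /w; case: (r == 0%N); last exact: cvg_cst.
  by apply: stride_weight_cvg0 => //; exact: ltnW.
pose x := limn (cantor_partial_sum R Q E).
have xN : normal_set R k Q x.
  move=> B; have [C CP] := EM B 1%N 0%N isT.
  apply: (@cvg_ratio_bounded_diff _ _ _ C) => [n|].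
    have := CP n; rewrite block_countE// expected_countE.
    rewrite (eq_bigl (occurs_stride B E 1)) => [|p]; last by rewrite !modn1.
    rewrite (eq_bigr (stride_weight R Q 1 k))// => p _.
    by rewrite big_mkcond !big_ord_recl big_ord0 /= addr0 addr0.
  rewrite (_ : expected_count R Q k = expected_count_mod R Q 1 0 k).
    by apply: fI => //; exact: ltnW.
  by apply/funext => n; apply: eq_bigl => p; rewrite !modn1.
have /(_ 2 k1 1%N isT [tuple of nseq k 0%N]) := sub x xN.
have [C CP] := EM [tuple of nseq k 0%N] 2 1%N isT.
apply: (@bounded_ratio_ncvg1 _ _ _ C) => [n|]; last by apply: fI => //; exact: ltnW.
have := CP n; rewrite block_count_modE// [X in _ - X]big1 ?subr0// => p _.
by rewrite big_mkcond !big_ord_recl big_ord0 /= add0r addr0.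
Qed.

(** Consecutive copies are spread evenly over all residue classes, but every
    block occurs only boundedly often with stride [k]. *)
Lemma normalI_not_normalII (R : realType) (k : nat) (Q : nat -> nat) :
  (1 < k)%N -> admissible R Q ->
  ~ (normalI_set R k Q `<=` normalII_set R k Q).
Proof.
move=> k1 [bQ Qoo fI fII] sub; have k0 := ltnW k1.
have [||E [EQ EM Ee]] :=
    @block_design R k Q 1 k`! (residue_weight R Q 1 k k`!) k1 (ltnW k1) (fact_gt0 k) Qoo.
- by move=> r p; exact: residue_weight_ge0.
- by move=> r; exact: residue_weight_cvg0.
pose x := limn (cantor_partial_sum R Q E).
have xI : normalI_set R k Q x.
  move=> m /= /andP[m0 mk] r /= rm B.
  have mM : (m %| k`!)%N by apply: dvdn_fact; rewrite m0.
  have [C CP] := EM B m r mM.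
  apply: (@cvg_ratio_bounded_diff _ _ _ C) => [n|]; last exact: fI.
  have := CP n; rewrite block_count_modE// expected_count_modE.
  by rewrite sum_residue_weight ?fact_gt0.
have /(_ 0%N k0 [tuple of nseq k 0%N]) := sub x xI.
have [||C CP] := Ee [tuple of nseq k 0%N] k.
- by rewrite k0 leqnn.
- by move=> a ak; rewrite mul1n => ka; rewrite ka ltnn in ak.
apply: (@bounded_ratio_ncvg1 _ _ _ C) => [n|]; last exact: fII.
apply: le_trans (CP (n * k)%N); rewrite block_count_Upsilon//.
rewrite !ger0_norm// ler_nat big_mkcond [leqRHS]big_mkcond.
by apply: leq_sum => p _; case: (_ == _); case: occurs_stride.
Qed.

(** Copies with stride [k] are spread evenly over the residue classes modulo
    [k], but every block occurs only boundedly often at consecutive positions. *)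
Lemma normalII_not_normal (R : realType) (k : nat) (Q : nat -> nat) :
  (1 < k)%N -> admissible R Q ->
  ~ (normalII_set R k Q `<=` normal_set R k Q).
Proof.
move=> k1 [bQ Qoo fI fII] sub; have k0 := ltnW k1.
have kk : (0 < k <= k)%N by rewrite k0 leqnn.
have [||E [EQ EM Ee]] :=
    @block_design R k Q k k (residue_weight R Q k k k) k1 kk k0 Qoo.
- by move=> r p; exact: residue_weight_ge0.
- by move=> r; exact: residue_weight_cvg0.
pose x := limn (cantor_partial_sum R Q E).
have xII : normalII_set R k Q x.
  move=> r /= rk B; have [C CP] := EM B k r (dvdnn k).
  apply: (@cvg_ratio_bounded_diff _ _ _ C) => [n|]; last exact: fII.
  have := CP (n * k)%N; rewrite block_count_Upsilon// expected_count_Lambda.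
  by rewrite sum_residue_weight// sum_progression.
have := sub x xII [tuple of nseq k 0%N].
have [||C CP] := Ee [tuple of nseq k 0%N] 1%N.
- by rewrite k0.
- by move=> a ak /esym/eqP; rewrite muln_eq1 => /andP[/eqP]; lia.
apply: (@bounded_ratio_ncvg1 _ _ _ C) => [n|]; first by rewrite block_countE.
rewrite (_ : expected_count R Q k = expected_count_mod R Q 1 0 k).
  exact: fI.
by apply/funext => n; apply: eq_bigl => p; rewrite !modn1.
Qed.

Unset Implicit Arguments.

Theorem theorem1p13 (R : realType) (k : nat) (hk : (2 <= k)%N) :
  (forall Q : nat -> nat, admissible R Q ->
     normalI_set R k Q `<=` normal_set R k Q) /\
  (exists Q : nat -> nat, admissible R Q /\
     ~ (normal_set R k Q `<=` normalI_set R k Q)) /\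
  (exists Q : nat -> nat, admissible R Q /\
     ~ (normal_set R k Q `<=` normalII_set R k Q)) /\
  (exists Q : nat -> nat, admissible R Q /\
     ~ (normalI_set R k Q `<=` normalII_set R k Q)) /\
  (exists Q : nat -> nat, admissible R Q /\
     ~ (normalII_set R k Q `<=` normal_set R k Q)) /\
  (exists Q : nat -> nat, admissible R Q /\
     ~ (normalII_set R k Q `<=` normalI_set R k Q)).
Proof.
have IN Q := @normalI_sub_normal R k Q (ltnW hk).
have adm := admissible_slow_base R.
split; first by move=> Q _; exact: IN.
split; first by exists slow_base; split => //; exact: normal_not_normalI.
split.
  exists slow_base; split => // NII.
  exact: normalI_not_normalII hk adm (subset_trans (IN _) NII).
split; first by exists slow_base; split => //; exact: normalI_not_normalII.
split; first by exists slow_base; split => //; exact: normalII_not_normal.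
exists slow_base; split => // III.
exact: normalII_not_normal hk adm (subset_trans III (IN _)).
Qed.
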